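(* Let $p,q,r\in[0,1]$ with $p+q+r=1$ and $0<r<1$, let $s\in[0,1]$, and let $(S_n)$ be the elephant random walk with stops (ERWS) with parameters $p,q,r,s$. Assume the diffusive regime $\frac{p}{1-r}<\frac34$. Then $$\lim_{n\to\infty}\frac{S_n}{n}=0\qquad\text{almost surely}.$$
   Context: The elephant random walk with stops (ERWS) is defined as follows. The parameters are $p,q,r\in[0,1]$ with $p+q+r=1$, where $0<r<1$ is assumed throughout, and $s\in[0,1]$. The first step $X_1$ equals $+1$ with probability $s$ and $-1$ with probability $1-s$. For each $n\ge 1$, given $X_1,\dots,X_n$, an integer $k$ is chosen uniformly at random in $\{1,\dots,n\}$ and, independently of this choice and of the past, $X_{n+1}=X_k$ with probability $p$, $X_{n+1}=-X_k$ with probability $q$, and $X_{n+1}=0$ with probability $r$. The position of the ERWS is $S_0=0$ and $S_n=\sum_{k=1}^n X_k$ for $n\ge1$. *)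

(* Defs.v *)
From HB Require Import structures.
From mathcomp Require Import all_boot all_order all_algebra.
From mathcomp Require Import all_classical all_reals all_analysis.

Set Implicit Arguments.
Unset Strict Implicit.
Unset Printing Implicit Defensive.

Import Order.TTheory GRing.Theory Num.Theory.
Import numFieldNormedType.Exports.
Local Open Scope classical_set_scope.
Local Open Scope ring_scope.

(* The sigma-algebra sigma(X_1, ..., X_n); steps are indexed from 1, and
   X 0 is a dummy that plays no role anywhere. *)
Definition past d (T : measurableType d) (R : realType) (P : probability T R)
    (X : nat -> {RV P >-> R}) (n : nat) : set (set T) :=
  <<s \bigcup_(i in [set i | (1 <= i <= n)%N])
        preimage_set_system [set: T] (X i) measurable >>.

(* For n >= 1, K n is the random time remembered by the elephant when it
   chooses X_(n+1), and eps n is the (random) factor applied to the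
   remembered step: 1 (repeat), -1 (reverse) or 0 (stop).  The field
   [erws_indep] states that the past sigma(X_1, ..., X_n), K n and eps n are
   mutually independent; taking A, B or C to be the whole space gives
   pairwise independence. *)
Record is_ERWS d (T : measurableType d) (R : realType) (P : probability T R)
    (p q r s : R) (X : nat -> {RV P >-> R})
    (K : nat -> {RV P >-> nat}) (eps : nat -> {RV P >-> R}) : Prop := {
  erws_first_pos : P (X 1%N @^-1` [set 1]) = s%:E ;
  erws_first_neg : P (X 1%N @^-1` [set -1]) = (1 - s)%:E ;
  erws_memory : forall n k : nat, (1 <= k <= n)%N ->
    P (K n @^-1` [set k]) = (n%:R^-1)%:E ;
  erws_repeat : forall n : nat, (1 <= n)%N ->
    P (eps n @^-1` [set 1]) = p%:E ;
  erws_reverse : forall n : nat, (1 <= n)%N ->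
    P (eps n @^-1` [set -1]) = q%:E ;
  erws_stop : forall n : nat, (1 <= n)%N ->
    P (eps n @^-1` [set 0]) = r%:E ;
  erws_indep : forall n : nat, (1 <= n)%N ->
    forall (A : set T) (B : set nat) (C : set R),
      past X n A -> measurable B -> measurable C ->
      P (A `&` (K n @^-1` B) `&` (eps n @^-1` C)) =
        (P A * P (K n @^-1` B) * P (eps n @^-1` C))%E ;
  erws_step : forall n : nat, (1 <= n)%N ->
    {ae P, forall w, X n.+1 w = eps n w * X (K n w) w}
}.

Definition position d (T : measurableType d) (R : realType)
    (P : probability T R) (X : nat -> {RV P >-> R}) (n : nat) (w : T) : R :=
  \sum_(1 <= k < n.+1) X k w.

(* Main.v *)
Require Import Defs.
From HB Require Import structures.
From mathcomp Require Import all_boot all_order all_algebra.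
From mathcomp Require Import all_classical all_reals all_analysis.
From mathcomp Require Import measurable_realfun zify ring lra.

Set Implicit Arguments.
Unset Strict Implicit.
Unset Printing Implicit Defensive.

Import Order.TTheory GRing.Theory Num.Theory.
Import numFieldNormedType.Exports.
Local Open Scope classical_set_scope.
Local Open Scope ring_scope.

(** The proof is a second-moment argument.  Write [a = p - q]; since
    [p + q = 1 - r], the diffusive condition [p / (1 - r) < 3 / 4] says
    [a < (1 - r) / 2], so that [a < 1 / 2].

    Given the past, the next step is on average [a] times the mean of the
    previous steps, that is [a * S_n / n].  Expanding
    [S_(n+1)^2 = S_n^2 + 2 S_n X_(n+1) + X_(n+1)^2] and using [|X_(n+1)| <= 1]
    gives [E S_(n+1)^2 <= (1 + 2 a / n) E S_n^2 + 1] ([second_moment_step]).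
    Because [2 a < 1], this recursion forces [E S_n^2 <= C n]
    ([second_moment_linear]).

    Along the squares, [E (S_(k^2) / k^2)^2 <= C / k^2] is summable, so
    [S_(k^2) / k^2] tends to 0 almost surely ([ae_cvg0_of_summable]).  As every
    step has absolute value at most 1, the walk moves by at most [2 k] between
    [k^2] and [(k + 1)^2], which extends the convergence to all times
    ([cvg_mean_of_squares]).

    No conditional expectation is formed.  Every step takes its values in
    [{1, -1, 0}] almost surely and hence equals the difference of the
    indicators of [X n = 1] and [X n = -1] ([sign_step]).  The product of two
    steps is then a combination of four indicators of past events, and
    the average of [S_n X_(n+1)] comes from the product rule for the events
    (past event), [K n = k], [eps n = x] alone ([Rintegral_recall],
    [Rintegral_position_step]).  Working with [sign_step] also makes all
    functions bounded everywhere, so that every expectation is a real number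
    and linearity needs no integrability argument beyond boundedness. *)

(** * Deterministic estimates *)

Lemma ex_nat_sqrt (n : nat) : exists k : nat, (k * k <= n < k.+1 * k.+1)%N.
Proof.
elim: n => [|n [k /andP[kn nk]]]; first by exists 0%N.
have [nk1|nk1] := ltnP n.+1 (k.+1 * k.+1); first by exists k; rewrite nk1 leqW.
by exists k.+1; rewrite nk1 /=; apply: leq_ltn_trans nk _; lia.
Qed.

(** If [j + 1] is the integer square root of [n], the sum up to [n] differs from
    the sum up to [(j + 1)^2] by at most [2 (j + 1)], which is negligible against
    [n >= (j + 1)^2].  The hypothesis is on the square of the mean because the
    second-moment bound controls exactly that quantity. *)
Lemma cvg_mean_of_squares (R : realType) (x : nat -> R) :
    (forall k, `|x k| <= 1) ->
    (fun j => ((\sum_(1 <= k < (j.+1 * j.+1).+1) x k) / (j.+1 * j.+1)%:R) ^+ 2)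
      @ \oo --> (0 : R) ->
  (fun n => (\sum_(1 <= k < n.+1) x k) / n%:R) @ \oo --> (0 : R).
Proof.
move=> x1 sq0; apply/cvgrPdist_le => e e0.
have e20 : 0 < (e / 2) ^+ 2 by rewrite exprn_gt0// divr_gt0.
move/cvgrPdist_lt : sq0 => /(_ _ e20)[N _ HN].
have [M _ HM] := (@cvgrPdist_lt _ _ _ _ _ _ _).1 (@cvg_harmonic R) (e / 4)
  ltac:(by rewrite divr_gt0).
exists ((N + M).+1 * (N + M).+1)%N => //= n /= nNM.
have [k /andP[kn nk]] := ex_nat_sqrt n.
have : (N + M < k)%N.
  rewrite ltnNge -ltnS; apply/negP => kNM.
  by have := leq_trans nk (leq_trans (leq_mul kNM kNM) nNM); rewrite ltnn.
case: k kn nk => // j jn nj NMj.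
have {HN} := HN j ltac:(by rewrite /=; lia).
have {HM} := HM j ltac:(by rewrite /=; lia).
rewrite /harmonic/= !sub0r !normrN normrX.
rewrite (@gtr0_norm _ j.+1%:R^-1) ?invr_gt0// => je /ltW ue.
set a := \sum_(1 <= k < _) _ in ue.
rewrite (@big_cat_nat _ _ _ (j.+1 * j.+1).+1)//=.
set b := \sum_(_ <= k < n.+1) _; rewrite -/a.
have bj : `|b| <= (2 * j.+1)%:R.
  apply: (le_trans (ler_norm_sum _ _ _)).
  apply: (@le_trans _ _ (\sum_((j.+1 * j.+1).+1 <= k < n.+1) 1)).
    exact: ler_sum.
  by rewrite big_const_nat iter_addr_0 ler_nat; lia.
have ue' : `|a / (j.+1 * j.+1)%:R| <= e / 2.
  by rewrite -ler_sqr ?nnegrE// ltW// divr_gt0.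
have j0 : 0 < (j.+1 * j.+1)%:R :> R by rewrite ltr0n.
have n0 : 0 < n%:R :> R by rewrite ltr0n; lia.
have nj2 : (j.+1 * j.+1)%:R <= n%:R :> R by rewrite ler_nat.
rewrite normrM normfV (gtr0_norm n0) ler_pdivrMr//.
apply: (le_trans (ler_normD _ _)).
move: ue'; rewrite normrM normfV (gtr0_norm j0) ler_pdivrMr// => ue'.
have bje : (2 * j.+1)%:R <= e / 2 * (j.+1 * j.+1)%:R.
  rewrite !natrM.
  have j10 : 0 < j.+1%:R :> R by rewrite ltr0n.
  have : 1 <= (e / 4) * j.+1%:R by rewrite -ler_pdivrMr// div1r ltW.
  by nra.
apply: (@le_trans _ _ (e * (j.+1 * j.+1)%:R)); first by lra.
by rewrite ler_pM2l.
Qed.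

Lemma sum_inv_squares_le2 (R : realFieldType) (n : nat) :
  \sum_(0 <= j < n) ((j.+1 * j.+1)%:R^-1 : R) <= 2.
Proof.
case: n => [|n]; first by rewrite big_geq.
(* Telescoping bound: 1/(n+2)^2 <= 1/(n+1) - 1/(n+2). *)
suff H : \sum_(0 <= j < n.+1) ((j.+1 * j.+1)%:R^-1 : R) <= 2 - n.+1%:R^-1.
  by apply: le_trans H _; rewrite gerBl invr_ge0.
elim: n => [|n ih]; first by rewrite big_nat1 invr1; lra.
rewrite big_nat_recr//=; apply: le_trans (lerD ih (lexx _)) _.
rewrite -addrA lerD2l natrM.
have -> : n.+2%:R = n.+1%:R + 1 :> R by rewrite -natr1.
have x0 : 0 < n.+1%:R :> R by rewrite ltr0n.
move: {ih} (n.+1%:R) x0 => x x0.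
have x00 : x != 0 by rewrite gt_eqF.
have x10 : x + 1 != 0 by rewrite gt_eqF// addr_gt0.
rewrite -subr_ge0.
have -> : - (x + 1)^-1 - (- x^-1 + ((x + 1) * (x + 1))^-1) =
    (x * (x + 1) * (x + 1))^-1 by field; rewrite x00 x10.
by rewrite invr_ge0 !mulr_ge0// ?addr_ge0// ltW.
Qed.

(** The line [n / (1 - b)] is the solution of the recursion with equality, since
    [(1 + b / n) * (n / (1 - b)) + 1 = (n + 1) / (1 - b)]; the factor
    [1 + b / n] is nonnegative, so induction keeps [m] below that line. *)
Lemma linear_growth (R : realFieldType) (b : R) (m : nat -> R) :
    0 <= b < 1 -> m 1%N <= 1 ->
    (forall n, (1 <= n)%N -> m n.+1 <= (1 + b / n%:R) * m n + 1) ->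
  forall n, (1 <= n)%N -> m n <= n%:R / (1 - b).
Proof.
move=> /andP[b0 b1] m1 mS; elim=> // -[_ _|n ih _].
  by rewrite ler_pdivlMr; nra.
have {}ih := ih isT.
have n0 : 0 < n.+1%:R :> R by rewrite ltr0n.
apply: (le_trans (mS n.+1 isT)).
have -> : n.+2%:R = n.+1%:R + 1 :> R by rewrite -natr1.
move: (m n.+1) (n.+1%:R) n0 ih => y x x0 yx.
have b10 : 1 - b != 0 by lra.
have x00 : x != 0 by lra.
have -> : (x + 1) / (1 - b) = (1 + b / x) * (x / (1 - b)) + 1.
  by field; rewrite b10 x00.
rewrite lerD2r ler_wpM2l// addr_ge0// divr_ge0//; exact: ltW.
Qed.

(** * Expectations of bounded measurable functions *)

Section BoundedExpectation.
Context d (T : measurableType d) (R : realType) (P : probability T R).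

Definition bounded_measurable (f : T -> R) :=
  measurable_fun [set: T] f /\ exists M : R, forall w, `|f w| <= M.

Lemma bounded_measurable_integrable f :
  bounded_measurable f -> P.-integrable [set: T] (EFin \o f).
Proof.
move=> [mf [M fM]]; apply: measurable_bounded_integrable => //.
  exact: le_lt_trans (probability_le1 P measurableT) (ltry _).
exists M; split; first exact: num_real.
by move=> N MN w _ /=; exact: le_trans (fM w) (ltW MN).
Qed.

Lemma bounded_measurable_cst (c : R) : bounded_measurable (fun=> c).
Proof. by split; [exact: measurable_cst|exists `|c|]. Qed.

Lemma bounded_measurable_indic (A : set T) :
  measurable A -> bounded_measurable \1_A.
Proof.
move=> mA; split; first exact: measurable_indic.
by exists 1 => w; rewrite indicE normr_nat lern1 leq_b1.
Qed.

Lemma bounded_measurableD f g : bounded_measurable f -> bounded_measurable g ->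
  bounded_measurable (fun w => f w + g w).
Proof.
move=> [mf [M fM]] [mg [N gN]]; split; first exact: measurable_funD.
by exists (M + N) => w; rewrite (le_trans (ler_normD _ _))// lerD.
Qed.

Lemma bounded_measurableB f g : bounded_measurable f -> bounded_measurable g ->
  bounded_measurable (fun w => f w - g w).
Proof.
move=> [mf [M fM]] [mg [N gN]]; split; first exact: measurable_funB.
by exists (M + N) => w; rewrite (le_trans (ler_normB _ _))// lerD.
Qed.

Lemma bounded_measurableM f g : bounded_measurable f -> bounded_measurable g ->
  bounded_measurable (fun w => f w * g w).
Proof.
move=> [mf [M fM]] [mg [N gN]]; split; first exact: measurable_funM.
by exists (M * N) => w; rewrite normrM ler_pM.
Qed.

Lemma bounded_measurable_sum (I : Type) (s : seq I) (f : I -> T -> R) :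
    (forall i, bounded_measurable (f i)) ->
  bounded_measurable (fun w => \sum_(i <- s) f i w).
Proof.
move=> bf; elim: s => [|i s ih].
  by under eq_fun do rewrite big_nil; exact: bounded_measurable_cst.
under eq_fun do rewrite big_cons.
exact: bounded_measurableD.
Qed.

Lemma Rintegral_sum (I : Type) (s : seq I) (f : I -> T -> R) :
    (forall i, bounded_measurable (f i)) ->
  \int[P]_w (\sum_(i <- s) f i w) = \sum_(i <- s) \int[P]_w f i w.
Proof.
move=> bf; elim: s => [|i s ih].
  rewrite big_nil; under eq_Rintegral do rewrite big_nil.
  by rewrite Rintegral_cst// mul0r.
rewrite big_cons -ih -RintegralD//; last 2 first.
- exact: bounded_measurable_integrable.
- exact/bounded_measurable_integrable/bounded_measurable_sum.
by apply: eq_Rintegral => w _; rewrite big_cons.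
Qed.

Lemma Rintegral_indic (A : set T) :
  measurable A -> \int[P]_w \1_A w = fine (P A).
Proof. by move=> mA; rewrite /Rintegral integral_indic// setIT. Qed.

Lemma Rintegral_le1 (f : T -> R) : bounded_measurable f ->
  (forall w, f w <= 1) -> \int[P]_w f w <= 1.
Proof.
move=> bf f1; apply: (@le_trans _ _ (\int[P]_w 1)).
  apply: le_Rintegral => //; first exact: bounded_measurable_integrable.
  exact/bounded_measurable_integrable/bounded_measurable_cst.
by rewrite Rintegral_cst// mul1r -lee_fin fineK ?fin_num_measure// probability_le1.
Qed.

Lemma ae_eq_Rintegral (f g : T -> R) :
    bounded_measurable f -> bounded_measurable g ->
    {ae P, forall w, f w = g w} ->
  \int[P]_w f w = \int[P]_w g w.
Proof.
move=> [mf _] [mg _] fg; congr fine; apply: ae_eq_integral => //.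
- exact/measurable_EFinP.
- exact/measurable_EFinP.
by apply: filterS fg => w -> _.
Qed.

(** * Almost sure statements *)

Lemma probability1_ae (A : set T) :
  measurable A -> P A = 1%E -> {ae P, forall w, A w}.
Proof.
move=> mA PA; apply/negligibleP; first exact: measurableC.
by rewrite [LHS](probability_setC P mA) PA subee.
Qed.

(** A discrete law given by its point masses determines the support: if the
    masses of finitely many distinct values add up to 1, no other value is
    taken. *)
Lemma ae_mem_of_sum_eq1 (V : eqType) (Y : T -> V) (s : seq V) : uniq s ->
    (forall v, measurable (Y @^-1` [set v])) ->
    (\sum_(v <- s) P (Y @^-1` [set v]) = 1)%E ->
  {ae P, forall w, Y w \in s}.
Proof.
move=> us mY sum1.
suff [mYs PYs] : measurable (Y @^-1` [set` s]) /\
    P (Y @^-1` [set` s]) = (\sum_(v <- s) P (Y @^-1` [set v]))%E.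
  by apply: (probability1_ae mYs); rewrite PYs.
elim: s us {sum1} => [|v s ih] /=.
  by rewrite big_nil set_nil preimage_set0; split; [exact: measurable0|exact: measure0].
move=> /andP[vs /ih[mYs PYs]]; rewrite big_cons.
have -> : Y @^-1` [set` v :: s] = Y @^-1` [set v] `|` Y @^-1` [set` s].
  apply/seteqP; split=> w /=; rewrite inE.
    by case/predU1P => [|Ys]; [left|right].
  by case=> [->|->]; rewrite ?eqxx ?orbT.
split; first exact: measurableU.
rewrite -PYs; apply: measureU => //.
by rewrite -subset0 => w /= [-> ]; rewrite (negbTE vs).
Qed.

(** By monotone convergence the sum of the [f n] has a finite integral, hence is
    finite almost everywhere, and the terms of a convergent series tend to 0. *)
Lemma ae_cvg0_of_summable (f : nat -> T -> R) :
    (forall n, measurable_fun [set: T] (f n)) -> (forall n w, 0 <= f n w) ->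
    (\sum_(n <oo) \int[P]_w (f n w)%:E < +oo)%E ->
  {ae P, forall w, (fun n => f n w) @ \oo --> (0 : R)}.
Proof.
move=> mf f0 fy.
have mfE n : measurable_fun [set: T] (fun w => (f n w)%:E).
  exact/measurable_EFinP.
have int_sum : P.-integrable [set: T] (fun w => \sum_(n <oo) (f n w)%:E)%E.
  apply/integrableP; split.
    by apply: ge0_emeasurable_sum => // n w _ _; rewrite lee_fin.
  under eq_integral.
    move=> w _; rewrite gee0_abs; first over.
    by rewrite nneseries_ge0// => n _ _; rewrite lee_fin.
  by rewrite integral_nneseries// => n w _; rewrite lee_fin.
apply: filterS (integrable_ae measurableT int_sum) => w /(_ I) fin_w.
apply: cvg_series_cvg_0; apply: nnseries_is_cvg => //.
by rewrite ltey_eq fin_w.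
Qed.

(** * Product rule against an independent event *)

(** The integral form of uncorrelatedness with the event [G].  Being linear in
    [Y], it passes from indicators of events independent of [G] to the
    combinations needed below. *)
Definition factorizes (G : set T) (Y : T -> R) :=
  bounded_measurable Y /\
  \int[P]_w (Y w * \1_G w) = \int[P]_w Y w * fine (P G).

Lemma factorizes_indic (A G : set T) : measurable A -> measurable G ->
  P (A `&` G) = (P A * P G)%E -> factorizes G \1_A.
Proof.
move=> mA mG AG; split; first exact: bounded_measurable_indic.
rewrite Rintegral_indic// -fineM ?fin_num_measure// -AG.
rewrite -Rintegral_indic; last exact: measurableI.
by apply: eq_Rintegral => w _; rewrite indicI.
Qed.

Lemma factorizesD (G : set T) (Y Z : T -> R) : measurable G ->
  factorizes G Y -> factorizes G Z -> factorizes G (fun w => Y w + Z w).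
Proof.
move=> /bounded_measurable_indic bG [bY EY] [bZ EZ].
split; first exact: bounded_measurableD.
under eq_Rintegral do rewrite mulrDl.
rewrite !RintegralD ?EY ?EZ ?mulrDl//;
  by apply/bounded_measurable_integrable => //; apply: bounded_measurableM.
Qed.

Lemma factorizesB (G : set T) (Y Z : T -> R) : measurable G ->
  factorizes G Y -> factorizes G Z -> factorizes G (fun w => Y w - Z w).
Proof.
move=> /bounded_measurable_indic bG [bY EY] [bZ EZ].
split; first exact: bounded_measurableB.
under eq_Rintegral do rewrite mulrBl.
rewrite !RintegralB ?EY ?EZ ?mulrBl//;
  by apply/bounded_measurable_integrable => //; apply: bounded_measurableM.
Qed.

End BoundedExpectation.

(** * Steps as differences of indicators *)

Lemma indic_preimage1 (R : pzRingType) (T : Type) (V : eqType) (f : T -> V) v w :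
  \1_(f @^-1` [set v]) w = (f w == v)%:R :> R.
Proof.
by rewrite indicE; congr (_ %:R); congr nat_of_bool; apply/idP/eqP; rewrite inE.
Qed.

Section SignStep.
Context d (T : measurableType d) (R : realType) (P : probability T R).
Variable X : nat -> {RV P >-> R}.

(** A version of the step [X n], equal to it almost surely, which is bounded at
    every point and is a combination of indicators. *)
Definition sign_step (n : nat) (w : T) : R :=
  \1_(X n @^-1` [set 1]) w - \1_(X n @^-1` [set -1]) w.

Definition sign_position (n : nat) (w : T) : R :=
  \sum_(1 <= k < n.+1) sign_step k w.

Lemma measurable_fiber (n : nat) (x : R) : measurable (X n @^-1` [set x]).
Proof. exact: measurable_funPTI. Qed.

Lemma sign_stepE n w : X n w \in [:: 1; -1; 0] -> sign_step n w = X n w.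
Proof.
have e1N : (1 == -1 :> R) = false by apply/eqP => h; lra.
have eN1 : (-1 == 1 :> R) = false by apply/eqP => h; lra.
have e01 : (0 == 1 :> R) = false by apply/eqP => h; lra.
have e0N : (0 == -1 :> R) = false by apply/eqP => h; lra.
rewrite /sign_step !indic_preimage1 !inE => /or3P[] /eqP ->.
- by rewrite eqxx e1N subr0.
- by rewrite eqxx eN1 sub0r.
- by rewrite e01 e0N subr0.
Qed.

Lemma norm_sign_step_le1 n w : `|sign_step n w| <= 1.
Proof.
rewrite /sign_step !indicE; do 2 case: (_ \in _);
  by rewrite /= ?subrr ?subr0 ?sub0r ?normrN ?normr1 ?normr0.
Qed.

Lemma bounded_measurable_sign_step n : bounded_measurable (sign_step n).
Proof.
by apply: bounded_measurableB; apply: bounded_measurable_indic;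
  exact: measurable_fiber.
Qed.

Lemma bounded_measurable_sign_position n : bounded_measurable (sign_position n).
Proof. by apply: bounded_measurable_sum => i; exact: bounded_measurable_sign_step. Qed.

Lemma past_setT n : past X n [set: T].
Proof.
exact: (@measurableT _ (g_sigma_algebraType
  (\bigcup_(i in [set i | (1 <= i <= n)%N])
     preimage_set_system [set: T] (X i) measurable))).
Qed.

Lemma past_setI n (A B : set T) : past X n A -> past X n B -> past X n (A `&` B).
Proof.
exact: (@measurableI _ (g_sigma_algebraType
  (\bigcup_(i in [set i | (1 <= i <= n)%N])
     preimage_set_system [set: T] (X i) measurable))).
Qed.

Lemma past_fiber n i (x : R) : (1 <= i <= n)%N -> past X n (X i @^-1` [set x]).
Proof.
move=> hi; apply: sub_sigma_algebra; exists i => //.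
by exists [set x]; [exact: measurable_set1|rewrite setTI].
Qed.

(** The product of two steps is 1 or -1 on four events of the past and 0
    elsewhere, so the product rule for events is all that is needed. *)
Lemma factorizes_sign_stepM n i j (G : set T) : (1 <= i <= n)%N -> (1 <= j <= n)%N ->
    measurable G -> (forall A, past X n A -> P (A `&` G) = (P A * P G)%E) ->
  factorizes P G (fun w => sign_step i w * sign_step j w).
Proof.
move=> hi hj mG indep.
pose A x y := X i @^-1` [set x] `&` X j @^-1` [set y].
have fA x y : factorizes P G \1_(A x y).
  apply: factorizes_indic => //; first by apply: measurableI; exact: measurable_fiber.
  by apply: indep; apply: past_setI; exact: past_fiber.
have -> : (fun w => sign_step i w * sign_step j w) = (fun w =>
    (\1_(A 1 1) w + \1_(A (-1) (-1)) w) - (\1_(A 1 (-1)) w + \1_(A (-1) 1) w)).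
  by apply/funext => w; rewrite /sign_step /A !indicI /=; ring.
by apply: factorizesB => //; apply: factorizesD.
Qed.

End SignStep.

(** * Growth of the second moment *)

Section SecondMoment.
Context d (T : measurableType d) (R : realType) (P : probability T R).
Variables (p q r s : R) (X : nat -> {RV P >-> R}) (K : nat -> {RV P >-> nat}).
Variable eps : nat -> {RV P >-> R}.
Hypothesis hpqr : p + q + r = 1.
Hypothesis hX : is_ERWS p q r s X K eps.

Definition recalled (n k : nat) (x : R) : set T :=
  K n @^-1` [set k] `&` eps n @^-1` [set x].

Lemma measurable_memory n k : measurable (K n @^-1` [set k]).
Proof. exact: measurable_funPTI. Qed.

Lemma measurable_recalled n k x : measurable (recalled n k x).
Proof. by apply: measurableI; [exact: measurable_memory|exact: measurable_fiber]. Qed.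

Lemma recalled_indep n k x A : (1 <= n)%N -> past X n A ->
  P (A `&` recalled n k x) = (P A * P (recalled n k x))%E.
Proof.
move=> n1 pA.
have mk : measurable [set k] by [].
have := erws_indep hX n1 pA mk (measurable_set1 x).
have := erws_indep hX n1 (@past_setT _ _ _ _ X n) mk (measurable_set1 x).
rewrite setTI probability_setT mul1e /recalled setIA => -> ->.
by rewrite muleA.
Qed.

Lemma prob_recalled n k x (z : R) : (1 <= k <= n)%N ->
  P (eps n @^-1` [set x]) = z%:E -> fine (P (recalled n k x)) = z / n%:R.
Proof.
move=> hk ez.
have n1 : (1 <= n)%N by lia.
have mk : measurable [set k] by [].
have := erws_indep hX n1 (@past_setT _ _ _ _ X n) mk (measurable_set1 x).
rewrite setTI probability_setT mul1e /recalled => ->.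
by rewrite (erws_memory hX hk) ez -EFinM/= mulrC.
Qed.

(** The coefficient with which the step [X k] enters [X n.+1]: the value of
    [eps n] if the elephant remembers time [k], and 0 otherwise. *)
Definition recall (n k : nat) (w : T) : R :=
  \1_(recalled n k 1) w - \1_(recalled n k (-1)) w.

Lemma bounded_measurable_recall n k : bounded_measurable (recall n k).
Proof.
by apply: bounded_measurableB; apply: bounded_measurable_indic;
  exact: measurable_recalled.
Qed.

(** Time [k] is recalled with probability [1 / n] and then repeated with
    probability [p] or reversed with probability [q], independently of the
    past; this is where the drift [(p - q) / n] appears. *)
Lemma Rintegral_recall n i k : (1 <= i <= n)%N -> (1 <= k <= n)%N ->
  \int[P]_w (sign_step X i w * sign_step X k w * recall n k w) =
  (p - q) / n%:R * \int[P]_w (sign_step X i w * sign_step X k w).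
Proof.
move=> hi hk; have n1 : (1 <= n)%N by lia.
have fac x := factorizes_sign_stepM hi hk (measurable_recalled n k x)
  (fun A => @recalled_indep n k x A n1).
have [bXX E1] := fac 1; have [_ EN1] := fac (-1).
under eq_Rintegral do rewrite /recall mulrBr.
rewrite RintegralB//; last 2 first.
- by apply/bounded_measurable_integrable/bounded_measurableM => //;
    exact/bounded_measurable_indic/measurable_recalled.
- by apply/bounded_measurable_integrable/bounded_measurableM => //;
    exact/bounded_measurable_indic/measurable_recalled.
rewrite E1 EN1 (prob_recalled hk (erws_repeat hX n1)).
by rewrite (prob_recalled hk (erws_reverse hX n1)) -mulrBr -mulrBl mulrC.
Qed.

(** The first step is 1 or -1 and each later step is a value in [{1, -1, 0}]
    times an earlier step, so all steps lie in [{1, -1, 0}] by strong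
    induction.  The random index [K n w] is then removed by writing the
    recalled step as a sum over all times [k] of which one term survives. *)
Lemma ae_steps : {ae P, forall w, forall n, (1 <= n)%N ->
  X n w \in [:: 1; -1; 0] /\
  X n.+1 w = \sum_(1 <= k < n.+1) sign_step X k w * recall n k w}.
Proof.
have first : {ae P, forall w, X 1%N w \in [:: 1; -1]}.
  apply: ae_mem_of_sum_eq1.
  - by rewrite /= inE andbT; apply/eqP => h; lra.
  - exact: measurable_fiber.
  - rewrite !big_cons big_nil adde0 (erws_first_pos hX) (erws_first_neg hX).
    by rewrite -EFinD; congr (_%:E); ring.
have factor : {ae P, forall w, forall n, (1 <= n)%N -> eps n w \in [:: 1; -1; 0]}.
  apply: ae_foralln => n; have [n1|n1] := leqP 1 n; last first.
    by apply: filterS filterT => w _; lia.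
  suff : {ae P, forall w, eps n w \in [:: 1; -1; 0]} by apply: filterS.
  apply: ae_mem_of_sum_eq1.
  - by rewrite /= !inE negb_or andbT -andbA; apply/and3P; split; apply/eqP => h; lra.
  - exact: measurable_fiber.
  - rewrite !big_cons big_nil adde0 (erws_repeat hX n1) (erws_reverse hX n1).
    by rewrite (erws_stop hX n1) -!EFinD addrA hpqr.
have memory : {ae P, forall w, forall n, (1 <= n)%N -> K n w \in index_iota 1 n.+1}.
  apply: ae_foralln => n; have [n1|n1] := leqP 1 n; last first.
    by apply: filterS filterT => w _; lia.
  suff : {ae P, forall w, K n w \in index_iota 1 n.+1} by apply: filterS.
  apply: ae_mem_of_sum_eq1.
  - exact: iota_uniq.
  - exact: measurable_memory.
  - rewrite (eq_big_nat _ _ (F2 := fun=> (n%:R^-1)%:E)); last first.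
      by move=> k; rewrite ltnS; exact: (erws_memory hX).
    rewrite sumEFin big_const_nat iter_addr_0 subn1/=.
    by rewrite -(mulr_natr n%:R^-1 n) mulVf// pnatr_eq0; lia.
have step : {ae P, forall w, forall n, (1 <= n)%N ->
    X n.+1 w = eps n w * X (K n w) w}.
  apply: ae_foralln => n; have [n1|n1] := leqP 1 n; last first.
    by apply: filterS filterT => w _; lia.
  by apply: filterS (erws_step hX n1).
apply: filterS (filterI (filterI first factor) (filterI memory step)).
move=> w [[X1 epsw] [Kw stepw]].
have val n : (1 <= n)%N -> X n w \in [:: 1; -1; 0].
  elim/ltn_ind: n => -[//|[_ _|n ih _]].
    by move: X1; rewrite !inE => /orP[] ->; rewrite ?orbT.
  have := Kw n.+1 isT; rewrite mem_index_iota ltnS => /andP[K1 Kn].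
  have := ih _ (Kn : (K n.+1 w < n.+2)%N) K1; have := epsw n.+1 isT.
  rewrite (stepw n.+1 isT) !inE.
  by move=> /or3P[] /eqP -> /or3P[] /eqP ->;
    rewrite ?mulr0 ?mul0r ?mul1r ?mulN1r ?opprK ?eqxx ?orbT.
move=> n n1; split; first exact: val.
have := Kw n n1; rewrite mem_index_iota => Kn.
rewrite (stepw n n1) (bigD1_seq (K n w)) ?iota_uniq ?mem_index_iota//=.
rewrite big1 ?addr0; last first.
  move=> k kK; rewrite /recall /recalled !indicI /= !indic_preimage1.
  by rewrite eq_sym (negbTE kK) !mul0r subrr mulr0.
rewrite sign_stepE; last by apply: val; case/andP: Kn.
rewrite mulrC; congr (_ * _).
(* The factor [eps n w] also lies in {1, -1, 0}, so the decomposition of steps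
   into indicators applies to the sequence [eps]. *)
rewrite -[LHS](sign_stepE (epsw n n1)).
rewrite /recall /sign_step /recalled !indicI /=.
by rewrite !indic_preimage1 eqxx !mul1r.
Qed.

(** This is [E(X_(n+1) | past) = (p - q) S_n / n] integrated against [S_n]:
    both sides expand into double sums over pairs of earlier times, which agree
    term by term. *)
Lemma Rintegral_position_step n : (1 <= n)%N ->
  \int[P]_w (sign_position X n w * sign_step X n.+1 w) =
  (p - q) / n%:R * \int[P]_w (sign_position X n w ^+ 2).
Proof.
move=> n1.
have bS := bounded_measurable_sign_step X.
have bR := bounded_measurable_recall.
have bSS i k : bounded_measurable (fun w => sign_step X i w * sign_step X k w).
  exact: bounded_measurableM.
transitivity (\int[P]_w (\sum_(1 <= i < n.+1) \sum_(1 <= k < n.+1)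
    sign_step X i w * sign_step X k w * recall n k w)).
  apply: ae_eq_Rintegral.
  - by apply: bounded_measurableM => //; exact: bounded_measurable_sign_position.
  - apply: bounded_measurable_sum => i; apply: bounded_measurable_sum => k.
    exact: bounded_measurableM.
  apply: filterS ae_steps => w Xw; rewrite /sign_position mulr_suml.
  apply: eq_bigr => i _; rewrite (sign_stepE (Xw n.+1 isT).1).
  rewrite (Xw n n1).2 mulr_sumr.
  by apply: eq_bigr => k _; rewrite mulrA.
have -> : \int[P]_w (sign_position X n w ^+ 2) =
    \int[P]_w (\sum_(1 <= i < n.+1) \sum_(1 <= k < n.+1)
    sign_step X i w * sign_step X k w).
  apply: eq_Rintegral => w _; rewrite expr2 /sign_position mulr_suml.
  by apply: eq_bigr => i _; rewrite mulr_sumr.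
rewrite !Rintegral_sum; last 2 first.
- by move=> i; exact: bounded_measurable_sum.
- move=> i; apply: bounded_measurable_sum => k; exact: bounded_measurableM.
rewrite mulr_sumr; apply: eq_big_nat => i hi.
rewrite !Rintegral_sum//; last by move=> k; exact: bounded_measurableM.
by rewrite mulr_sumr; apply: eq_big_nat => k hk; exact: Rintegral_recall.
Qed.

Lemma second_moment_step n : (1 <= n)%N ->
  \int[P]_w (sign_position X n.+1 w ^+ 2) <=
  (1 + 2 * (p - q) / n%:R) * \int[P]_w (sign_position X n w ^+ 2) + 1.
Proof.
move=> n1.
have bS := bounded_measurable_sign_step X.
have bP := bounded_measurable_sign_position X.
have bI f : bounded_measurable f -> P.-integrable setT (EFin \o f).
  exact: bounded_measurable_integrable.
have bM f g : bounded_measurable f -> bounded_measurable g ->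
    bounded_measurable (fun w : T => f w * g w : R) := @bounded_measurableM _ _ _ f g.
have bD f g : bounded_measurable f -> bounded_measurable g ->
    bounded_measurable (fun w : T => f w + g w : R) := @bounded_measurableD _ _ _ f g.
(* The cross term is kept as a sum of two equal products, so that every
   summand is a product of two bounded functions. *)
have -> : \int[P]_w (sign_position X n.+1 w ^+ 2) =
    \int[P]_w (sign_position X n w * sign_position X n w
      + ((sign_position X n w * sign_step X n.+1 w
         + sign_position X n w * sign_step X n.+1 w)
      + sign_step X n.+1 w * sign_step X n.+1 w)).
  apply: eq_Rintegral => w _; rewrite {1}/sign_position big_nat_recr//=.
  by rewrite -/(sign_position X n w); ring.
rewrite !RintegralD//; try by apply: bI; auto.
rewrite Rintegral_position_step//.
have le1 : \int[P]_w (sign_step X n.+1 w * sign_step X n.+1 w) <= 1.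
  apply: Rintegral_le1; first exact: bM.
  move=> w; rewrite -expr2 -real_normK ?num_real// expr_le1//.
  exact: norm_sign_step_le1.
have -> : \int[P]_w (sign_position X n w * sign_position X n w) =
    \int[P]_w (sign_position X n w ^+ 2) by apply: eq_Rintegral.
rewrite addrA; apply: lerD => //.
by rewrite le_eqVlt; apply/orP; left; apply/eqP; ring.
Qed.

End SecondMoment.

(** A negative [p - q] is replaced by 0 in the recursion, which keeps the factor
    [1 + b / n] nonnegative; the condition [p - q < 1 / 2] is what makes
    [b < 1]. *)
Lemma second_moment_linear d (T : measurableType d) (R : realType)
    (P : probability T R) (p q r s : R) (X : nat -> {RV P >-> R})
    (K : nat -> {RV P >-> nat}) (eps : nat -> {RV P >-> R}) :
    p + q + r = 1 -> is_ERWS p q r s X K eps -> p - q < 1 / 2 ->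
  exists2 C : R, 0 <= C & forall n, (1 <= n)%N ->
    \int[P]_w (sign_position X n w ^+ 2) <= C * n%:R.
Proof.
move=> hpqr hX pq; pose b : R := Num.max 0 (2 * (p - q)).
have b01 : 0 <= b < 1 by rewrite /b le_max lexx/= gt_max ltr01/=; lra.
have /andP[b0 b1] := b01.
exists (1 - b)^-1; first by rewrite invr_ge0 subr_ge0 ltW.
move=> n n1; rewrite mulrC.
apply: (linear_growth (m := fun n => \int[P]_w (sign_position X n w ^+ 2))) => //.
- apply: Rintegral_le1.
    by apply: bounded_measurableM; exact: bounded_measurable_sign_position.
  move=> w; rewrite /sign_position big_nat1 -real_normK ?num_real// expr_le1//.
  exact: norm_sign_step_le1.
move=> k k1; apply: le_trans (second_moment_step hpqr hX k1) _.
rewrite lerD2r ler_wpM2r//; first by apply: Rintegral_ge0 => w _; exact: sqr_ge0.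
by rewrite lerD2l ler_wpM2r ?invr_ge0// /b le_max lexx orbT.
Qed.

(** * Law of large numbers *)

Theorem theorem3p1 (d : measure_display) (T : measurableType d) (R : realType)
    (P : probability T R) (p q r s : R)
    (X : nat -> {RV P >-> R}) (K : nat -> {RV P >-> nat})
    (eps : nat -> {RV P >-> R})
    (hp : 0 <= p <= 1) (hq : 0 <= q <= 1) (hr : 0 < r < 1)
    (hpqr : p + q + r = 1) (hs : 0 <= s <= 1)
    (hX : is_ERWS p q r s X K eps)
    (hdiff : p / (1 - r) < 3 / 4) :
  {ae P, forall w, (fun n : nat => position X n w / n%:R) @ \oo --> (0 : R)}.
Proof.
have pq : p - q < 1 / 2.
  by move: hdiff; rewrite ltr_pdivrMr; lra.
have [C C0 SC] := second_moment_linear hpqr hX pq.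
(* The index is shifted so that the square (j+1)^2 is never 0. *)
pose f j w := (sign_position X (j.+1 * j.+1) w / (j.+1 * j.+1)%:R) ^+ 2.
have bf j : bounded_measurable (f j).
  have bS := bounded_measurable_sign_position X (j.+1 * j.+1).
  have bc := @bounded_measurable_cst _ T R (j.+1 * j.+1)%:R^-1.
  by apply: bounded_measurableM; apply: bounded_measurableM.
have f0 j w : 0 <= f j w by exact: sqr_ge0.
have Ef j : \int[P]_w f j w <= C * ((j.+1 * j.+1)%:R^-1).
  have N0 : 0 < (j.+1 * j.+1)%:R :> R by rewrite ltr0n.
  under eq_Rintegral do rewrite /f expr_div_n.
  rewrite RintegralZr//; last first.
    apply: (@bounded_measurable_integrable _ _ _ P (fun w => sign_position X _ w ^+ 2)).
    by apply: bounded_measurableM; exact: bounded_measurable_sign_position.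
  rewrite ler_pdivrMr ?exprn_gt0// expr2 mulrA mulfVK ?gt_eqF//.
  exact: SC.
have fsum : (\sum_(j <oo) \int[P]_w (f j w)%:E < +oo)%E.
  apply: (@le_lt_trans _ _ (C * 2)%:E); last exact: ltry.
  apply: lime_le.
    by apply: is_cvg_nneseries => j _ _; apply: integral_ge0 => w _; rewrite lee_fin.
  apply: nearW => n.
  apply: (@le_trans _ _ (\sum_(0 <= j < n) (C * (j.+1 * j.+1)%:R^-1)%:E)%E).
    apply: lee_sum => j _.
    rewrite -[leLHS]fineK; first by rewrite lee_fin; exact: Ef.
    exact/integrable_fin_num/bounded_measurable_integrable.
  by rewrite sumEFin lee_fin -mulr_sumr ler_wpM2l// sum_inv_squares_le2.
have mf j : measurable_fun [set: T] (f j) by case: (bf j).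
have cvf := ae_cvg0_of_summable mf f0 fsum.
apply: filterS2 cvf (ae_steps hpqr hX) => w fw Xw.
have -> : (fun n => position X n w / n%:R) = (fun n => sign_position X n w / n%:R).
  apply/funext => n; congr (_ / _); apply: eq_big_nat => k /andP[k1 _].
  by rewrite sign_stepE//; have [] := Xw k k1.
exact: cvg_mean_of_squares (fun k => norm_sign_step_le1 X k w) fw.
Qed.
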